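(* Let $\langle F,E\rangle$ be a $w^*$-sequentially complete anti-dual pair, let $A,B\in\mathscr{L}_+(E,F)$ be positive operators, and let $B_s$ be the strong limit of the sequence $(B_n)$ given by $B_0:=B$, $B_{n+1}:=B_n-B_n:A$, where $:$ denotes the parallel sum. Then $$B-B_s=\max\{C\in\mathscr{L}_+(E,F)\,:\,C\le B,\ C\ll A\},$$ i.e. $B-B_s$ is the largest element of this set with respect to the order $\le$.
   Context: An anti-dual pair $\langle F,E\rangle$ consists of complex vector spaces $E,F$ and a map $\langle\cdot,\cdot\rangle:F\times E\to\mathbb{C}$, linear in the first and conjugate-linear in the second variable, that separates the points of both $E$ and $F$. It is $w^*$-sequentially complete if for every sequence $(f_n)$ in $F$ such that $(\langle f_n,x\rangle)_n$ is Cauchy for every $x\in E$ there is $f\in F$ with $\langle f_n,x\rangle\to\langle f,x\rangle$ for every $x\in E$. A linear operator $A:E\to F$ is positive if $\langle Ax,x\rangle\ge 0$ for all $x\in E$; $\mathscr{L}_+(E,F)$ is the set of positive operators (they are automatically weakly continuous). $S\le T$ means $\langle Sx,x\rangle\le\langle Tx,x\rangle$ for all $x\in E$. For $A,B\in\mathscr{L}_+(E,F)$ the parallel sum $A:B$ is the unique positive operator with $\langle (A:B)x,x\rangle=\inf\{\langle A(x-y),x-y\rangle+\langle By,y\rangle : y\in E\}$ for all $x\in E$; it always exists, is commutative, and satisfies $A:B\le A$, $A:B\le B$. The sequence $(B_n)$ consists of positive operators, and its strong limit $B_s\in\mathscr{L}_+(E,F)$, characterized by $\langle B_nx,y\rangle\to\langle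 B_sx,y\rangle$ for all $x,y\in E$, exists. $B\ll A$ ($B$ is $A$-absolutely continuous) means: for every sequence $(x_n)$ in $E$, $\langle Ax_n,x_n\rangle\to0$ and $\langle B(x_n-x_m),x_n-x_m\rangle\to0$ (as $n,m\to\infty$) imply $\langle Bx_n,x_n\rangle\to0$. *)

(* Defs.v *)
From mathcomp Require Export all_boot all_order all_algebra.
From mathcomp Require Export complex.
From mathcomp Require Export all_classical all_reals all_analysis.
Export numFieldNormedType.Exports.

Set Implicit Arguments.
Unset Strict Implicit.
Unset Printing Implicit Defensive.

Import Order.TTheory GRing.Theory Num.Theory.
Local Open Scope classical_set_scope.
Local Open Scope complex_scope.
Local Open Scope ring_scope.

(* [R : realType] is the field of real numbers and [R[i]] the field of complex
   numbers.  The usual metric topology on it is attached to the alias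
   [R[i]^o], hence the casts to it in the convergence statements below.  On
   [R[i]], [z <= w] means that [w - z] is a nonnegative real number. *)
Record anti_dual_pair (R : realType) (F E : lmodType R[i]) := AntiDualPair {
  pairing :> {bilinear F -> E -> R[i] | *%R & Num.conj \; *%R} ;
  pairing_sepl : forall f g : F, (forall x, pairing f x = pairing g x) -> f = g ;
  pairing_sepr : forall x y : E, (forall f, pairing f x = pairing f y) -> x = y
}.

Section AntiDualPairs.
Context (R : realType) (F E : lmodType R[i]) (W : anti_dual_pair F E).

Definition wstar_seq_complete : Prop :=
  forall f_ : nat -> F,
    (forall x, cauchy ((fun n => W (f_ n) x : R[i]^o) @ \oo)) ->
    exists f : F, forall x,
      (fun n => W (f_ n) x : R[i]^o) @ \oo --> (W f x : R[i]^o).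

Definition positive_op (A : {linear E -> F}) : Prop :=
  forall x, 0 <= W (A x) x.

Definition op_le (S T : {linear E -> F}) : Prop :=
  forall x, W (S x) x <= W (T x) x.

(* For positive [A] and [B] the numbers under the infimum are nonnegative
   reals, so taking real parts only changes their type from [R[i]] to [R]. *)
Definition is_parallel_sum (A B P : {linear E -> F}) : Prop :=
  positive_op P /\
  forall x, W (P x) x =
    (inf [set complex.Re (W (A (x - y)) (x - y) + W (B y) y)
         | y in [set: E]])%:C.

(* Definite description; the value [\0] is a placeholder for the case where no
   parallel sum exists. *)
Definition parallel_sum (A B : {linear E -> F}) : {linear E -> F} :=
  xget (\0 : {linear E -> F}) [set P | is_parallel_sum A B P].

Fixpoint parallel_seq (A B : {linear E -> F}) (n : nat) : {linear E -> F} :=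
  if n is m.+1 then
    parallel_seq A B m \- parallel_sum (parallel_seq A B m) A
  else B.

Definition is_strong_limit (T_ : nat -> {linear E -> F})
    (T : {linear E -> F}) : Prop :=
  positive_op T /\
  forall x y, (fun n => W (T_ n x) y : R[i]^o) @ \oo --> (W (T x) y : R[i]^o).

Definition strong_limit (T_ : nat -> {linear E -> F}) : {linear E -> F} :=
  xget (\0 : {linear E -> F}) [set T | is_strong_limit T_ T].

(* [abs_continuous B A] is [B << A]. *)
Definition abs_continuous (B A : {linear E -> F}) : Prop :=
  forall x_ : nat -> E,
    (fun n => W (A (x_ n)) (x_ n) : R[i]^o) @ \oo --> (0 : R[i]^o) ->
    (fun nm : nat * nat =>
       W (B (x_ nm.1 - x_ nm.2)) (x_ nm.1 - x_ nm.2) : R[i]^o)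
      @ (\oo, \oo) --> (0 : R[i]^o) ->
    (fun n => W (B (x_ n)) (x_ n) : R[i]^o) @ \oo --> (0 : R[i]^o).

Definition is_largest_op (S : set {linear E -> F}) (M : {linear E -> F}) : Prop :=
  S M /\ forall C, S C -> op_le C M.

End AntiDualPairs.

(* Main.v *)
From HB Require Import structures.
Require Import Defs.
From mathcomp Require Import ring lra.

Set Implicit Arguments.
Unset Strict Implicit.
Unset Printing Implicit Defensive.

Import Order.TTheory GRing.Theory Num.Theory.
Local Open Scope classical_set_scope.
Local Open Scope complex_scope.
Local Open Scope ring_scope.

(** Why the theorem is true.  Write [q_T(x)] for [<T x, x>] and [(U:V)(x)] for
    the infimum of [q_U(x - y) + q_V(y)] over [y].  Everything happens on the
    real quadratic forms [q_T] and on the real parts of the pairings, from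
    which the complex pairings are recovered by multiplying by [i].

    Both the parallel sums and the strong limit must first be constructed.  The
    functional [m = (U:V)] satisfies the parallelogram law and
    [m(c x) = |c|^2 m(x)], and almost minimizing vectors [y_n] at [x] give
    functionals [U (x - y_n)] that are nearly tangent to [m] at [x].  Weak-star
    sequential completeness turns them into an exact tangent; tangents are
    unique, and so depend linearly on [x]: they form the operator [U:V].  The
    strong limit comes from polarization, as [q_(B_n)(x)] decreases.

    Put [D = B - B_s].  It is the increasing limit of the operators [B - B_n],
    and [B - B_n <= n A] because every [B_k : A] is below [A].  An increasing
    limit of operators dominated by multiples of [A] is [A]-absolutely
    continuous, whence [D << A].

    For maximality the crucial inequality is, for [B_1 = B - B:A],
    [[
      (B : k A)  <=  (B_1 : k A) + (B : A).
    ]]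
    Heuristically, in the Hilbert space of [A + B] let [T] and [1 - T] represent
    [B] and [A].  The minimizer defining [B:A] at [z] is [T z], and [B:A], [B_1]
    are represented by [T (1 - T)] and [T^2], so that
    [[
      q_(B_1)(x - z) + (B:A)(x)  =  q_B(x - T z) + q_A(T z),
    ]]
    while [q_A(T z) <= q_A(z)]; so [y = T z] is a competitor for [B : k A] at
    [x] which is at least as good as [z] is for [B_1 : k A], up to [(B:A)(x)].
    The proof ([parq_step]) replaces [T z] by an almost minimizing vector.
    Telescoping along the sequence gives
    [[
      (B : k A)  <=  (B_n : k A) + q_B - q_(B_n),
    ]]
    and [(B_n : k A) <= k (B_n : A) = k (q_(B_n) - q_(B_(n+1)))] tends to [0].
    Hence [(B : k A) <= q_D] for all [k >= 1].  If [C <= B] then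
    [(C : k A) <= (B : k A) <= q_D], and if moreover [C << A] then [q_C] is the
    supremum of the [(C : k A)], so that [C <= D]. *)

(** * The real part of the pairing *)

Section RealPairing.
Context (R : realType) (F E : lmodType R[i]) (W : anti_dual_pair F E).
Implicit Types (f g : F) (x y z h : E) (s : R) (A B : {linear E -> F}).

Definition re_pairing f x : R := complex.Re (W f x).

Lemma re_pairingDl f g x :
  re_pairing (f + g) x = re_pairing f x + re_pairing g x.
Proof. by rewrite /re_pairing linearDl; case: (W f x) (W g x) => ? ? []. Qed.

Lemma re_pairingDr f x y :
  re_pairing f (x + y) = re_pairing f x + re_pairing f y.
Proof. by rewrite /re_pairing linearDr; case: (W f x) (W f y) => ? ? []. Qed.

Lemma re_pairingNl f x : re_pairing (- f) x = - re_pairing f x.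
Proof. by rewrite /re_pairing linearNl; case: (W f x). Qed.

Lemma re_pairingNr f x : re_pairing f (- x) = - re_pairing f x.
Proof. by rewrite /re_pairing linearNr; case: (W f x). Qed.

(** Moving a scalar across the real pairing conjugates it, which is the only
    trace that the complex structure leaves on the real part. *)
Lemma re_pairingZ (c : R[i]) f x :
  re_pairing (c *: f) x = re_pairing f (conjc c *: x).
Proof.
by rewrite /re_pairing linearZl_LR linearZr_LR /= [Num.conj _]conjcK.
Qed.

Lemma re_pairingZr s f x : re_pairing f (s%:C *: x) = s * re_pairing f x.
Proof.
rewrite /re_pairing linearZr_LR /=.
by case: (W f x) => a b /=; rewrite oppr0 mul0r subr0.
Qed.

Lemma re_pairingZl s f x : re_pairing (s%:C *: f) x = s * re_pairing f x.
Proof. by rewrite re_pairingZ conjc_real re_pairingZr. Qed.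

Lemma im_pairing f x : complex.Im (W f x) = re_pairing f ('i *: x).
Proof.
rewrite /re_pairing linearZr_LR /=.
by case: (W f x) => a b /=; rewrite mul0r sub0r mulN1r opprK.
Qed.

Lemma pairingE f x : W f x = re_pairing f x +i* re_pairing f ('i *: x).
Proof. by rewrite -im_pairing /re_pairing; case: (W f x). Qed.

Lemma re_pairing_inj f g : re_pairing f =1 re_pairing g -> f = g.
Proof.
by move=> fg; apply: (pairing_sepl (a := W)) => x; rewrite !pairingE !fg.
Qed.

End RealPairing.

(** * Convergence of complex numbers through real parts *)

Section ComplexConvergence.
Context (R : realType) (T : Type) (G : set_system T) (FG : Filter G).

Lemma norm_complex_le (a b : R) : `|a +i* b| <= (`|a| + `|b|)%:C.
Proof.
rewrite normc_def /= lecR -[leRHS]ger0_norm ?addr_ge0// -sqrtr_sqr.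
rewrite ler_sqrt ?sqr_ge0// sqrrD !real_normK ?num_real// lerD2r lerDl.
by rewrite mulrn_wge0 ?mulr_ge0.
Qed.

Lemma cvg_complex (f g : T -> R) (a b : R) :
  f @ G --> a -> g @ G --> b ->
  (fun t => f t +i* g t : R[i]^o) @ G --> (a +i* b : R[i]^o).
Proof.
move=> /cvgrPdist_le fa /cvgrPdist_le gb; apply/cvgrPdist_le => -[e e'].
rewrite ltcE /= => /andP[/eqP -> e0].
have e20 : 0 < e / 2 by rewrite divr_gt0.
near=> t; apply: (le_trans (norm_complex_le _ _)); rewrite lecR [leRHS]splitr.
by apply: lerD; near: t; [exact: fa|exact: gb].
Unshelve. all: by end_near. Qed.

Lemma cvg_Re (f : T -> R[i]) (l : R[i]) :
  (f : T -> R[i]^o) @ G --> (l : R[i]^o) ->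
  complex.Re (f t) @[t --> G] --> complex.Re l.
Proof.
move=> /cvgrPdist_le fl; apply/cvgrPdist_le => e e0.
near=> t; rewrite -lecR; apply: (@le_trans _ _ `|l - f t|); last first.
  by near: t; apply: fl; rewrite ltcR.
apply: le_trans (normc_ge_Re _).
by case: (l) (f t) => ? ? [].
Unshelve. all: by end_near. Qed.

End ComplexConvergence.

Section WeakConvergence.
Context (R : realType) (F E : lmodType R[i]) (W : anti_dual_pair F E).

Lemma cvg_pairing (f_ : nat -> F) (f : F) :
  (forall x, re_pairing W (f_ n) x @[n --> \oo] --> re_pairing W f x) ->
  forall x, (fun n => W (f_ n) x : R[i]^o) @ \oo --> (W f x : R[i]^o).
Proof.
move=> fc x; rewrite pairingE.
under eq_fun do rewrite pairingE.
exact: cvg_complex.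
Qed.

(** It suffices to control real parts because the imaginary part of the
    pairing at [x] is the real part at ['i *: x]. *)
Lemma re_wstar_seq_complete (f_ : nat -> F) :
  wstar_seq_complete W ->
  (forall x, cvg (re_pairing W (f_ n) x @[n --> \oo])) ->
  exists f, forall x, re_pairing W (f_ n) x @[n --> \oo] --> re_pairing W f x.
Proof.
move=> wc fc; have [x|f fP] := wc f_; last first.
  by exists f => x; exact: cvg_Re (fP x).
apply: cvg_cauchy.
apply: (@cvgP (R[i]^o) _ (lim (re_pairing W (f_ n) x @[n --> \oo])
         +i* lim (re_pairing W (f_ n) ('i *: x) @[n --> \oo]))).
under eq_fun do rewrite pairingE.
by apply: cvg_complex; exact: fc.
Qed.

End WeakConvergence.

(** * Real quadratic forms of positive operators *)

Section RealForms.
Context (R : realType) (F E : lmodType R[i]) (W : anti_dual_pair F E).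
Implicit Types (x y z h : E) (s k : R) (A B U V : {linear E -> F}).

Definition rform A x y : R := re_pairing W (A x) y.
Definition qform A x : R := rform A x x.

Lemma rformDl A x y z : rform A (x + y) z = rform A x z + rform A y z.
Proof. by rewrite /rform linearD re_pairingDl. Qed.

Lemma rformDr A x y z : rform A x (y + z) = rform A x y + rform A x z.
Proof. exact: re_pairingDr. Qed.

Lemma rformNl A x y : rform A (- x) y = - rform A x y.
Proof. by rewrite /rform linearN re_pairingNl. Qed.

Lemma rformNr A x y : rform A x (- y) = - rform A x y.
Proof. exact: re_pairingNr. Qed.

Lemma rformZl A s x y : rform A (s%:C *: x) y = s * rform A x y.
Proof. by rewrite /rform linearZ re_pairingZl. Qed.

Lemma rformZr A s x y : rform A x (s%:C *: y) = s * rform A x y.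
Proof. exact: re_pairingZr. Qed.

Definition rformE :=
  (rformDl, rformDr, rformNl, rformNr, rformZl, rformZr).

Lemma qformN A x : qform A (- x) = qform A x.
Proof. by rewrite /qform !rformE opprK. Qed.

Lemma qformZ A (c : R[i]) x :
  qform A (c *: x) = (complex.Re c ^+ 2 + complex.Im c ^+ 2) * qform A x.
Proof.
rewrite /qform /rform linearZ re_pairingZ scalerA -re_pairingZr.
congr (re_pairing _ _ (_ *: _)); case: c => a b /=; simpc.
by congr (_ +i* _); ring.
Qed.

Lemma qformB_op A B x : qform (A \- B) x = qform A x - qform B x.
Proof. by rewrite /qform /rform /= re_pairingDl re_pairingNl. Qed.

Lemma qformZ_op k A x : qform (k%:C \*: A) x = k * qform A x.
Proof. by rewrite /qform /rform /= re_pairingZl. Qed.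

Lemma qform_polar A x y :
  qform A (x + y) - qform A (x - y) = 2 * (rform A x y + rform A y x).
Proof. by rewrite /qform !rformE; ring. Qed.

Lemma qform_ge0 A x : positive_op W A -> 0 <= qform A x.
Proof. by move=> /(_ x); rewrite lecE => /andP[]. Qed.

Lemma pairing_qform A x : positive_op W A -> W (A x) x = (qform A x)%:C.
Proof.
move=> /(_ x)/ger0_Im; rewrite im_pairing pairingE /= => ->.
by rewrite complexr0.
Qed.

Lemma op_leP A B : positive_op W A -> positive_op W B ->
  op_le W A B <-> forall x, qform A x <= qform B x.
Proof.
move=> A0 B0; split=> AB x; have := AB x;
  by rewrite !pairing_qform// lecR.
Qed.

(** Positivity makes [W (A x) y + W (A y) x] real; testing this on ['i *: y]
    gives the symmetry of the real part. *)
Lemma rformC A x y : positive_op W A -> rform A x y = rform A y x.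
Proof.
move=> A0; have im z : re_pairing W (A z) ('i *: z) = 0.
  by rewrite -im_pairing ger0_Im.
have := im (x + 'i *: y); rewrite linearD linearZ scalerDr scalerA.
rewrite !(re_pairingDl, re_pairingDr) im !re_pairingZ !scalerA.
rewrite (_ : conjc 'i * 'i = 1) ?scale1r; last by simpc.
rewrite (_ : conjc 'i * ('i * 'i) = 'i); last by simpc.
rewrite im (_ : 'i * 'i = (-1)%:C); last by simpc.
by rewrite re_pairingZr /rform; lra.
Qed.

Lemma qformD A x y : positive_op W A ->
  qform A (x + y) = qform A x + 2 * rform A x y + qform A y.
Proof. by move=> A0; rewrite /qform !rformE (rformC y x)//; ring. Qed.

Lemma qformB A x y : positive_op W A ->
  qform A (x - y) = qform A x - 2 * rform A x y + qform A y.
Proof. by move=> A0; rewrite qformD// qformN !rformE; ring. Qed.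

Lemma qformZ_real A s x : qform A (s%:C *: x) = s ^+ 2 * qform A x.
Proof. by rewrite qformZ /=; ring. Qed.

Lemma qform0 A : qform A 0 = 0.
Proof. by rewrite -(scale0r (0 : E)) qformZ /= expr0n addr0 mul0r. Qed.

Lemma qform_parallelogram A x y :
  qform A (x + y) + qform A (x - y) = 2 * qform A x + 2 * qform A y.
Proof. by rewrite /qform !rformE; ring. Qed.

Lemma qformD_le A x y : positive_op W A ->
  qform A (x + y) <= 2 * qform A x + 2 * qform A y.
Proof.
by move=> A0; rewrite -qform_parallelogram lerDl qform_ge0.
Qed.

(** The inequality [2 * s * rform A x y <= s ^+ 2 * qform A x + qform A y],
    that is [0 <= qform A (s x - y)], inserted in the expansion of
    [qform A (x + y)].  After division by [s], the factor of [qform A x] tends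
    to [1] as [s] tends to [0]. *)
Lemma qformD_le_scaled A s x y : positive_op W A ->
  s * qform A (x + y) <= (s + s ^+ 2) * qform A x + (1 + s) * qform A y.
Proof.
move=> A0; have := qform_ge0 (s%:C *: x - y) A0.
by rewrite qformB// qformD// qformZ_real !rformE; nra.
Qed.

Lemma positive_opZ k A : 0 <= k -> positive_op W A ->
  positive_op W (k%:C \*: A).
Proof.
by move=> k0 A0 x; rewrite /= linearZl_LR /= mulr_ge0// ?ler0c//; exact: A0.
Qed.

Lemma positive_opB A B : positive_op W A -> positive_op W B ->
  (forall x, qform B x <= qform A x) -> positive_op W (A \- B).
Proof.
move=> A0 B0 BA x; rewrite /= linearBl !pairing_qform//.
by rewrite -rmorphB ler0c subr_ge0.
Qed.

End RealForms.

(** * Operators from quadratic functionals *)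

(** A nonzero [D] would make the linear term win for [s] small and of the sign
    of [D]. *)
Lemma linear_le_square (R : realFieldType) (D Q : R) :
  (forall s, s * D <= s ^+ 2 * Q) -> D = 0.
Proof.
move=> DQ; have Q0 : 0 <= Q by have := DQ 1; have := DQ (-1); lra.
have Q1 : 0 < Q + 1 by lra.
have := DQ (D / (Q + 1)).
have -> : D / (Q + 1) * D = (D / (Q + 1)) ^+ 2 * (Q + 1) by field; lra.
rewrite -subr_le0 -mulrBr addrAC subrr add0r mulr1 => Dle.
have /eqP : (D / (Q + 1)) ^+ 2 = 0 by apply/eqP; rewrite eq_le Dle sqr_ge0.
by rewrite sqrf_eq0 mulf_eq0 invr_eq0 (gt_eqF Q1) orbF => /eqP.
Qed.

Lemma halfD (R : realType) (E : lmodType R[i]) (x : E) :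
  x = 2^-1%:C *: x + 2^-1%:C *: x.
Proof.
by rewrite -scalerDl -rmorphD (_ : 2^-1 + 2^-1 = 1 :> R) ?scale1r//; field.
Qed.

Section Tangents.
Context (R : realType) (F E : lmodType R[i]) (W : anti_dual_pair F E).
Variables (m : E -> R) (U : {linear E -> F}).
Hypothesis m_ge0 : forall x, 0 <= m x.
Hypothesis m_parallelogram : forall x y,
  m (x + y) + m (x - y) = 2 * m x + 2 * m y.
Hypothesis mZ : forall (c : R[i]) x,
  m (c *: x) = (complex.Re c ^+ 2 + complex.Im c ^+ 2) * m x.
Hypothesis m_le : forall x, m x <= qform W U x.

(** [2 * re_pairing W f h] is a linear approximation of [m (x + h) - m x] with
    an error quadratic in [h]; only the upper bound is required, since convexity
    of [m] gives the lower one. *)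
Definition tangent (x : E) (f : F) : Prop :=
  forall h, m (x + h) <= m x + 2 * re_pairing W f h + qform W U h.

Lemma mid_convex x h : 2 * m x <= m (x + h) + m (x - h).
Proof. by rewrite m_parallelogram lerDl mulr_ge0. Qed.

Lemma tangent_unique x f g : tangent x f -> tangent x g -> f = g.
Proof.
move=> fx gx; apply: (re_pairing_inj (W := W)) => h.
apply/eqP; rewrite -subr_eq0; apply/eqP.
apply: (@linear_le_square _ _ (qform W U h)) => s.
have := mid_convex x (s%:C *: h).
have := fx (- (s%:C *: h)); have := gx (s%:C *: h).
by rewrite qformN qformZ_real re_pairingNr !re_pairingZr; lra.
Qed.

(** The tangent inequalities at [x] and [y] in the direction [h / 2] add up,
    through the parallelogram law, to the one at [x + y] with exactly the same
    error term. *)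
Lemma tangentD x y f g : tangent x f -> tangent y g -> tangent (x + y) (f + g).
Proof.
move=> fx gy h; pose k : E := 2^-1%:C *: h.
have hE : h = k + k by exact: halfD.
have := m_parallelogram (x + k) (y + k).
rewrite opprD addrACA -hE addrACA subrr addr0.
have := m_parallelogram x y.
have := fx k; have := gy k; rewrite qformZ_real !re_pairingDl re_pairingZr.
by rewrite re_pairingZr; lra.
Qed.

Lemma tangentZ (c : R[i]) x f : tangent x f -> tangent (c *: x) (c *: f).
Proof.
move=> fx h; have [->|c0] := eqVneq c 0.
  rewrite !scale0r add0r (_ : m 0 = 0); last first.
    by rewrite -(scale0r x) mZ /=; ring.
  by rewrite /re_pairing linear0l /=; have := m_le h; lra.
pose n := complex.Re c ^+ 2 + complex.Im c ^+ 2.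
have nE : n%:C = conjc c * c.
  by rewrite /n; case: (c) => a b; simpc; congr (_ +i* _); ring.
pose k := c^-1 *: h; have hE : h = c *: k by rewrite scalerA divff ?scale1r.
have -> : re_pairing W (c *: f) h = n * re_pairing W f k.
  by rewrite re_pairingZ hE scalerA -nE re_pairingZr.
rewrite {1 2}hE -scalerDr !mZ qformZ -/n.
have := ler_wpM2l (_ : 0 <= n) (fx k); rewrite addr_ge0 ?sqr_ge0//.
by move=> /(_ isT); lra.
Qed.

(** The radial derivative of the quadratic functional [m] at [x] is
    [2 * m x]. *)
Lemma tangent_diag x f : tangent x f -> re_pairing W f x = m x.
Proof.
move=> fx; suff : 2 * m x - 2 * re_pairing W f x = 0 by lra.
apply: (@linear_le_square _ _ (qform W U x - m x)) => s.
have := fx (s%:C *: x); rewrite qformZ_real re_pairingZr.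
rewrite (_ : x + s%:C *: x = (1 + s)%:C *: x); last first.
  by rewrite rmorphD scalerDl rmorph1 scale1r.
by rewrite mZ /=; nra.
Qed.

(** [m] is stationary at [x] in the direction ['i *: x], as
    [m ((1 + i s) x) = (1 + s ^+ 2) * m x]; this makes the operator of tangents
    positive, and not merely of nonnegative real part. *)
Lemma tangent_im x f : tangent x f -> re_pairing W f ('i *: x) = 0.
Proof.
move=> fx; suff : - 2 * re_pairing W f ('i *: x) = 0 by lra.
apply: (@linear_le_square _ _ (qform W U x - m x)) => s.
have := fx (s%:C *: ('i *: x)).
rewrite qformZ_real qformZ re_pairingZr.
rewrite (_ : x + s%:C *: ('i *: x) = (1 +i* s) *: x); last first.
  rewrite scalerA -[X in X + _ = _]scale1r -scalerDl.
  by congr (_ *: _); simpc.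
by rewrite mZ /=; nra.
Qed.

Hypothesis wc : wstar_seq_complete W.
Hypothesis near_tangent : forall x (e : R), 0 < e -> exists f, forall h,
  m (x + h) <= m x + e + 2 * re_pairing W f h + qform W U h.

(** Two functionals tangent at [x] up to errors [a] and [b] satisfy, by
    convexity of [m] along [s h], the bound
    [2 s |<f - g, h>| <= a + b + 2 s^2 q_U(h)].  For [s] small first and then
    [a], [b] small, this makes [re_pairing W (f_ n) h] a Cauchy sequence. *)
Lemma tangent_exists x : exists f, tangent x f.
Proof.
have /choice[f_ fP] : forall n, exists f, forall h,
    m (x + h) <= m x + harmonic n + 2 * re_pairing W f h + qform W U h.
  by move=> n; apply: near_tangent; exact: harmonic_gt0.
have [h|f fc] := re_wstar_seq_complete (W := W) (f_ := f_) wc; last first.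
  exists f => h.
  have lc : m x + harmonic n + 2 * re_pairing W (f_ n) h + qform W U h
      @[n --> \oo] --> m x + 0 + 2 * re_pairing W f h + qform W U h.
    apply: cvgD; last exact: cvg_cst.
    apply: cvgD; last by apply: cvgM; [exact: cvg_cst|exact: fc].
    by apply: cvgD; [exact: cvg_cst|exact: cvg_harmonic].
  rewrite -[m x]addr0.
  by apply: (ler_cvg_to (cvg_cst _) lc); near=> n; exact: fP.
apply/cauchy_cvgP/cauchy_exP => e e0.
pose Q := qform W U h; have Q0 : 0 <= Q.
  by apply: le_trans (m_le h); exact: m_ge0.
(* [s] makes the quadratic error [s * Q] at most [e / 4]; the index [N] then
   makes the two remaining errors, divided by [2 * s], at most [e / 4]. *)
have s0 : 0 < e / (4 * (Q + 1)) by rewrite divr_gt0// mulr_gt0// ltr_wpDl.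
set s := e / _ in s0; have sQ : s * (Q + 1) = e / 4.
  by rewrite /s; field; lra.
have se0 : 0 < s * e / 4 by rewrite divr_gt0// mulr_gt0.
have /cvgrPdist_lt/(_ _ se0)[N _ NP] := @cvg_harmonic R.
have hN n : (N <= n)%N -> harmonic n < s * e / 4.
  by move=> /NP /=; rewrite sub0r normrN ger0_norm// ltW// harmonic_gt0.
exists (re_pairing W (f_ N) h); exists N => // n /= Nn.
have half (a b : nat) : (N <= a)%N -> (N <= b)%N ->
    re_pairing W (f_ a) h - re_pairing W (f_ b) h < e.
  move=> /hN ha /hN hb; have := mid_convex x (s%:C *: h).
  have := fP b (s%:C *: h); have := fP a (- (s%:C *: h)).
  rewrite qformN !qformZ_real re_pairingNr !re_pairingZr -/Q => h1 h2 h3.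
  rewrite -(ltr_pM2l s0); have : s * s * Q <= s * e / 4 by nra.
  nra.
have := half n N Nn (leqnn N); have := half N n (leqnn N) Nn.
by rewrite /ball /= ltr_norml => ? ?; apply/andP; split; lra.
Unshelve. all: by end_near. Qed.

(** The operator sends [x] to the tangent at [x]; it is linear because tangents
    are unique and are compatible with sums and multiples. *)
Lemma quadratic_op :
  exists P : {linear E -> F}, positive_op W P /\ qform W P =1 m.
Proof.
have /choice[p pP] := tangent_exists.
have pL : linear p.
  move=> c x y; apply: (tangent_unique (pP _)).
  exact: tangentD (tangentZ c (pP x)) (pP y).
pose P : {linear E -> F} := HB.pack p (GRing.isLinear.Build _ _ _ _ p pL).
have PE : qform W P =1 m by move=> x; exact: tangent_diag (pP x).
exists P; split=> // x; rewrite pairingE (tangent_im (pP x)) lecE /= eqxx /=.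
by rewrite [X in _ <= X]PE.
Qed.

End Tangents.

(** * Parallel sums *)

Section ParallelSum.
Context (R : realType) (F E : lmodType R[i]) (W : anti_dual_pair F E).
Implicit Types (x y z h : E) (A B U V P : {linear E -> F}).

Definition parq U V x : R :=
  inf [set qform W U (x - y) + qform W V y | y in [set: E]].

Section Infimum.
Variables U V : {linear E -> F}.
Hypotheses (U0 : positive_op W U) (V0 : positive_op W V).

Lemma le_parq x (M : R) :
  (forall y, M <= qform W U (x - y) + qform W V y) -> M <= parq U V x.
Proof.
move=> MP; apply: lb_le_inf.
  by exists (qform W U (x - 0) + qform W V 0), 0.
by move=> _ [y _ <-].
Qed.

Lemma parq_le x y : parq U V x <= qform W U (x - y) + qform W V y.
Proof.
apply: ge_inf; last by exists y.
by exists 0 => _ [z _ <-]; rewrite addr_ge0// qform_ge0.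
Qed.

Lemma parq_ge0 x : 0 <= parq U V x.
Proof. by apply: le_parq => y; rewrite addr_ge0// qform_ge0. Qed.

Lemma parq_near x (e : R) : 0 < e ->
  exists y, qform W U (x - y) + qform W V y <= parq U V x + e.
Proof.
move=> e0; apply: contrapT => /forallNP ne.
have : parq U V x + e <= parq U V x.
  by apply: le_parq => y; apply/ltW; rewrite ltNge; apply/negP/ne.
by lra.
Qed.

Lemma parq_lel x : parq U V x <= qform W U x.
Proof. by have := parq_le x 0; rewrite subr0 qform0 addr0. Qed.

Lemma parq_ler x : parq U V x <= qform W V x.
Proof. by have := parq_le x x; rewrite subrr qform0 add0r. Qed.

(** The substitution [y := c y] in the infimum. *)
Lemma parqZ_le (c : R[i]) x :
  parq U V (c *: x) <= (complex.Re c ^+ 2 + complex.Im c ^+ 2) * parq U V x.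
Proof.
set n := (X in X * _); have n0 : 0 <= n by rewrite addr_ge0 ?sqr_ge0.
apply/ler_addgt0Pr => e e0.
have [|y yP] := parq_near x (e := e / (n + 1)).
  by rewrite divr_gt0// ltr_wpDl.
have := parq_le (c *: x) (c *: y); rewrite -scalerBr !qformZ -/n -mulrDr.
move=> /le_trans; apply; apply: (le_trans (ler_wpM2l n0 yP)).
rewrite mulrDr lerD2l mulrCA -[leRHS]mulr1 ler_pM2l//.
by rewrite ler_pdivrMr ?mul1r ?lerDl// ltr_wpDl.
Qed.

Lemma parqZ (c : R[i]) x :
  parq U V (c *: x) = (complex.Re c ^+ 2 + complex.Im c ^+ 2) * parq U V x.
Proof.
have [->|c0] := eqVneq c 0.
  rewrite scale0r /= expr0n addr0 mul0r; apply/eqP.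
  by rewrite eq_le parq_ge0 andbT -(qform0 W U) parq_lel.
set n := (X in X * _).
pose n' := complex.Re c^-1 ^+ 2 + complex.Im c^-1 ^+ 2.
have nn' : n * n' = 1.
  apply: complexI; rewrite rmorphM /= !add_Re2_Im2 -exprMn -normrM.
  by rewrite divff// normr1 expr1n.
apply/eqP; rewrite eq_le parqZ_le -[x in leLHS](scalerK c0).
have n0 : 0 <= n by rewrite addr_ge0 ?sqr_ge0.
apply: le_trans (ler_wpM2l n0 (parqZ_le c^-1 (c *: x))) _.
by rewrite -/n' mulrA nn' mul1r.
Qed.

(** If [y] and [w] are nearly optimal at [x] and [z], then [y + w] and [y - w]
    compete at [x + z] and [x - z]. *)
Lemma parq_parallelogram_le x z :
  parq U V (x + z) + parq U V (x - z) <= 2 * parq U V x + 2 * parq U V z.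
Proof.
apply/ler_addgt0Pr => e e0; have e4 : 0 < e / 4 by rewrite divr_gt0.
have [y yP] := parq_near x e4; have [w wP] := parq_near z e4.
have := parq_le (x + z) (y + w).
rewrite (_ : x + z - (y + w) = (x - y) + (z - w)); last first.
  by rewrite opprD addrACA.
have := parq_le (x - z) (y - w).
rewrite (_ : x - z - (y - w) = (x - y) - (z - w)); last first.
  by rewrite !opprB addrACA [RHS]addrACA [- z - y]addrC.
have := qform_parallelogram W U (x - y) (z - w).
have := qform_parallelogram W V y w; lra.
Qed.

(** The reverse inequality is [parq_parallelogram_le] at [x + z] and [x - z]. *)
Lemma parq_parallelogram x z :
  parq U V (x + z) + parq U V (x - z) = 2 * parq U V x + 2 * parq U V z.
Proof.
apply/eqP; rewrite eq_le parq_parallelogram_le /=.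
have := parq_parallelogram_le (x + z) (x - z).
have -> : x + z + (x - z) = 2%:C *: x.
  by rewrite addrACA subrr addr0 rmorph_nat scaler_nat mulr2n.
have -> : x + z - (x - z) = 2%:C *: z.
  rewrite opprB [x + z]addrC addrACA subrr addr0.
  by rewrite rmorph_nat scaler_nat mulr2n.
rewrite !parqZ /=; lra.
Qed.

End Infimum.

Lemma parqZr_le U V (k : R) x :
  positive_op W U -> positive_op W V -> 1 <= k ->
  parq U (k%:C \*: V) x <= k * parq U V x.
Proof.
move=> U0 V0 k1; have k0 : 0 < k by exact: lt_le_trans k1.
have kV0 : positive_op W (k%:C \*: V) by exact: positive_opZ (ltW k0) V0.
rewrite -ler_pdivrMl//; apply: le_parq => y; rewrite ler_pdivrMl//.
apply: le_trans (parq_le U0 kV0 x y) _; rewrite qformZ_op mulrDr lerD2r.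
by rewrite ler_peMl// qform_ge0.
Qed.

Lemma parqE U V x :
  inf [set complex.Re (W (U (x - y)) (x - y) + W (V y) y) | y in [set: E]]
  = parq U V x.
Proof.
congr inf; apply: eq_imagel => y _; rewrite /qform /rform /re_pairing.
by case: (W _ _) (W _ _) => ? ? [].
Qed.

Lemma is_parallel_sumP U V P : is_parallel_sum W U V P <->
  positive_op W P /\ qform W P =1 parq U V.
Proof.
split=> -[P0 PE]; split=> // x.
  by apply: complexI; rewrite -pairing_qform// PE parqE.
by rewrite parqE pairing_qform// PE.
Qed.

(** If [y] is nearly optimal at [x], keeping it fixed while [x] moves shows that
    [U (x - y)] is nearly tangent at [x]. *)
Lemma parallel_sum_exists U V : wstar_seq_complete W ->
  positive_op W U -> positive_op W V -> exists P, is_parallel_sum W U V P.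
Proof.
move=> wc U0 V0.
have near x (e : R) : 0 < e -> exists f, forall h,
    parq U V (x + h) <= parq U V x + e + 2 * re_pairing W f h + qform W U h.
  move=> e0; have [y yP] := parq_near U V x e0; exists (U (x - y)) => h.
  have := parq_le U0 V0 (x + h) y.
  rewrite addrAC qformD//.
  have -> : rform W U (x - y) h = re_pairing W (U (x - y)) h by [].
  lra.
have [P [P0 PE]] := quadratic_op (parq_ge0 U0 V0) (parq_parallelogram U0 V0)
  (parqZ U0 V0) (parq_lel U0 V0) wc near.
by exists P; apply/is_parallel_sumP.
Qed.

Lemma parallel_sumP U V : wstar_seq_complete W ->
  positive_op W U -> positive_op W V ->
  positive_op W (parallel_sum W U V) /\
  qform W (parallel_sum W U V) =1 parq U V.
Proof.
move=> wc U0 V0; apply/is_parallel_sumP.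
have [P PP] := parallel_sum_exists wc U0 V0.
exact: (@xgetPex _ _ [set P | is_parallel_sum W U V P] (ex_intro _ P PP)).
Qed.

End ParallelSum.

(** * Strong limits *)

Section StrongLimit.
Context (R : realType) (F E : lmodType R[i]) (W : anti_dual_pair F E).
Variable T_ : nat -> {linear E -> F}.
Hypothesis T_pos : forall n, positive_op W (T_ n).
Hypothesis T_decr : forall n x, qform W (T_ n.+1) x <= qform W (T_ n) x.

Lemma qform_homo x :
  {homo (fun n => qform W (T_ n) x) : n m / (n <= m)%N >-> m <= n}.
Proof. by apply/nonincreasing_seqP => n. Qed.

Lemma is_cvg_qform x : cvg (qform W (T_ n) x @[n --> \oo]).
Proof.
apply: nonincreasing_is_cvgn; first exact: qform_homo.
by exists 0 => _ [n _ <-]; exact: qform_ge0.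
Qed.

(** Polarization expresses each sequence [re_pairing W (T_ n x) y] by two
    monotone ones. *)
Lemma strong_limit_exists : wstar_seq_complete W ->
  exists T, is_strong_limit W T_ T.
Proof.
move=> wc.
have cr x y : cvg (re_pairing W (T_ n x) y @[n --> \oo]).
  have rE n : re_pairing W (T_ n x) y =
      4^-1 * (qform W (T_ n) (x + y) - qform W (T_ n) (x - y)).
    by rewrite qform_polar (rformC y x)// /rform; field.
  under eq_fun do rewrite rE.
  by apply: is_cvgM; [exact: is_cvg_cst|apply: is_cvgB; exact: is_cvg_qform].
have /choice[t tP] x := re_wstar_seq_complete wc (cr x).
have tL : linear t.
  move=> c x y; apply: (re_pairing_inj (W := W)) => h.
  apply: (cvg_unique _ (tP (c *: x + y) h)) => //.
  rewrite re_pairingDl re_pairingZ (_ : (fun n => _) = fun n =>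
    re_pairing W (T_ n x) (conjc c *: h) + re_pairing W (T_ n y) h).
    by apply: cvgD; exact: tP.
  by apply: funext => n; rewrite linearP re_pairingDl re_pairingZ.
pose T : {linear E -> F} := HB.pack t (GRing.isLinear.Build _ _ _ _ t tL).
exists T; split; last by move=> x; apply: cvg_pairing; exact: tP.
move=> x; rewrite pairingE lecE /=; apply/andP; split.
  have c := tP x ('i *: x).
  apply/eqP/(cvg_unique _ c) => //.
  rewrite (_ : (fun n => _) = cst 0); first exact: cvg_cst.
  by apply: funext => n /=; rewrite -im_pairing ger0_Im//; exact: T_pos.
apply: (ler_cvg_to (cvg_cst _) (tP x x)); near=> n.
exact: (qform_ge0 x (T_pos n)).
Unshelve. all: by end_near. Qed.

Lemma strong_limitP : wstar_seq_complete W ->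
  positive_op W (strong_limit W T_) /\
  forall x, qform W (T_ n) x @[n --> \oo] --> qform W (strong_limit W T_) x.
Proof.
move=> wc; have [T TP] := strong_limit_exists wc.
have [S0 SP] : is_strong_limit W T_ (strong_limit W T_).
  exact: (@xgetPex _ _ [set T | is_strong_limit W T_ T] (ex_intro _ T TP)).
by split=> // x; exact: cvg_Re (SP x x).
Qed.

End StrongLimit.

(** * One subtraction step *)

Section SubtractionStep.
Context (R : realType) (F E : lmodType R[i]) (W : anti_dual_pair F E).
Variables A B P : {linear E -> F}.
Hypotheses (A0 : positive_op W A) (B0 : positive_op W B) (P0 : positive_op W P).
Hypothesis PE : qform W P =1 parq W B A.

(** Here [y] plays the part of [T z], with [s ^+ 2] the defect of optimality.
    An exact minimizer satisfies [<P z, x> = <B (z - y), x>] and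
    [<B (z - y), y> = <A y, y>].  Moving [z] to [z - s x], respectively [y] to
    [y - s y], in the infimum and dividing by [s] gives the halves [Dx] and [Dy]
    of these identities up to errors of order [s]. *)
Lemma near_minimizer_ineq (s : R) x z y : 0 < s -> s <= 1 ->
  qform W B (z - y) + qform W A y <= qform W P z + s ^+ 2 ->
  qform W B (x - y) <= qform W B (x - z) - qform W P (x - z) + qform W P x
    + s * (4 + qform W B x + 2 * qform W B z + 2 * qform W P z).
Proof.
move=> s0 s1 yP.
have Dx : 2 * rform W B (z - y) x
    <= 2 * rform W P z x + s * (1 + qform W B x).
  rewrite -(ler_pM2l s0).
  have := parq_le B0 A0 (z - s%:C *: x) y.
  rewrite -PE addrAC !(@qformB _ _ _ _ P, @qformB _ _ _ _ B (z - y))//.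
  rewrite !qformZ_real !rformE; have := qform_ge0 x P0; nra.
have Dy : 2 * (qform W A y - rform W B (z - y) y)
    <= s * (1 + qform W B y + qform W A y).
  rewrite -(ler_pM2l s0).
  have := parq_le B0 A0 z (y - s%:C *: y); rewrite -PE.
  rewrite (_ : z - (y - _) = (z - y) + s%:C *: y); last first.
    by rewrite opprB addrA addrAC.
  rewrite (@qformD _ _ _ _ B)// (@qformB _ _ _ _ A)// !qformZ_real !rformE.
  rewrite -/(qform W A y); nra.
have yb : qform W B y + qform W A y <= 2 * qform W B z + 2 * qform W P z + 2.
  have := qformD_le z (- (z - y)) B0; rewrite qformN subKr.
  have := qform_ge0 y A0; nra.
have Pz : qform W P z <= qform W B (z - y) + qform W A y by rewrite PE parq_le.
have e1 : qform W B (x - y) = qform W B (x - z) + 2 * rform W B (z - y) x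
    - qform W B z + qform W B y.
  by rewrite !qformB// !rformE (rformC z x)// (rformC y x)//; ring.
have e2 : qform W P (x - z) = qform W P x - 2 * rform W P z x + qform W P z.
  by rewrite qformB// (rformC z x).
have e3 : qform W B z =
    qform W B (z - y) + 2 * rform W B (z - y) y + qform W B y.
  by rewrite -qformD// subrK.
have := ler_wpM2l (ltW s0) yb; have := qform_ge0 y A0.
by rewrite e1 e2; lra.
Qed.

(** Given [z], the vector [y] that nearly minimizes at [z] the infimum defining
    [P] is tested in the infimum on the left: [near_minimizer_ineq] compares the
    terms in [B], and [qform W A y <= qform W A z + s] those in [A]. *)
Lemma parq_step (k : R) x : 0 <= k ->
  parq W B (k%:C \*: A) x <= parq W (B \- P) (k%:C \*: A) x + qform W P x.
Proof.
move=> k0; have kA0 := positive_opZ k0 A0.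
apply/ler_addgt0Pr => e e0; have e20 : 0 < e / 2 by rewrite divr_gt0.
have [z zP] := parq_near W (B \- P) (k%:C \*: A) x e20.
pose K := 4 + k + qform W B x + 2 * qform W B z + 2 * qform W P z.
have K0 : 0 < K.
  rewrite /K; have := qform_ge0 x B0; have := qform_ge0 z B0.
  by have := qform_ge0 z P0; lra.
(* This choice ensures both [s <= 1] and [s * K <= e / 2]. *)
pose s := e / 2 / (K + e / 2).
have Ke : 0 < K + e / 2 by rewrite addr_gt0.
have s0 : 0 < s by rewrite divr_gt0.
have s1 : s <= 1 by rewrite ler_pdivrMr// mul1r lerDr ltW.
have sK : s * K <= e / 2.
  by rewrite /s mulrAC ler_pdivrMr// ler_pM2l// lerDl ltW.
have [|y yP] := parq_near W B A z (e := s ^+ 2); first by rewrite exprn_gt0.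
rewrite -PE in yP.
have := near_minimizer_ineq x s0 s1 yP.
have := parq_le B0 kA0 x y.
have ay : qform W A y <= qform W A z + s.
  have := parq_ler B0 A0 z; rewrite -PE; have := qform_ge0 (z - y) B0; nra.
move: zP; rewrite !qformZ_op qformB_op.
have := ler_wpM2l k0 ay; rewrite /K in sK; lra.
Qed.

End SubtractionStep.

(** * Absolute continuity *)

Section AbsoluteContinuity.
Context (R : realType) (F E : lmodType R[i]) (W : anti_dual_pair F E).
Variables A C : {linear E -> F}.
Hypotheses (A0 : positive_op W A) (C0 : positive_op W C).

Lemma abs_continuousP : abs_continuous W C A <->
  forall x_ : nat -> E,
    qform W A (x_ n) @[n --> \oo] --> 0 ->
    (fun nm => qform W C (x_ nm.1 - x_ nm.2)) @ (\oo, \oo) --> 0 ->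
    qform W C (x_ n) @[n --> \oo] --> 0.
Proof.
have up (T : Type) (G : set_system T) (FG : Filter G) (B : {linear E -> F})
    (z : T -> E) : positive_op W B -> qform W B (z t) @[t --> G] --> 0 ->
    (fun t => W (B (z t)) (z t) : R[i]^o) @ G --> (0 : R[i]^o).
  move=> B0 q0; under eq_fun do rewrite pairing_qform//.
  exact: (@cvg_complex _ _ _ _ _ (fun=> 0) 0 0 q0 (cvg_cst _)).
split=> CA x_ a0 c0.
  exact: cvg_Re (CA x_ (up _ _ _ _ _ A0 a0) (up _ _ _ _ _ C0 c0)).
by apply: up => //; apply: CA; [exact: cvg_Re a0|exact: cvg_Re c0].
Qed.

(** Let [y n] nearly minimize [qform W C (x - y) + n.+1 * qform W A y].  The
    minimal values are bounded, so [qform W A (y n)] tends to [0]; they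
    converge, being nondecreasing, and the parallelogram law at the midpoint of
    [y n] and [y l] makes [y] a Cauchy sequence for [C].  By absolute continuity
    [qform W C (y n)] tends to [0], so that [qform W C x] is the limit of
    [qform W C (x - y n)]. *)
Lemma abs_continuous_le_parq (M : R) x : abs_continuous W C A ->
  (forall k : R, 1 <= k -> parq W C (k%:C \*: A) x <= M) -> qform W C x <= M.
Proof.
move=> /abs_continuousP CA parqM.
pose a (n : nat) : {linear E -> F} := n.+1%:R%:C \*: A.
have a0 n : positive_op W (a n) by exact: positive_opZ.
have aE n y : qform W (a n) y = n.+1%:R * qform W A y by exact: qformZ_op.
pose m n := parq W C (a n) x.
have mM n : m n <= M by apply: parqM; rewrite ler1n.
have m_homo : nondecreasing_seq m.
  apply/nondecreasing_seqP => n; apply: le_parq => y.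
  apply: le_trans (parq_le C0 (a0 n) x y) _; rewrite lerD2l !aE.
  by apply: ler_wpM2r; [exact: qform_ge0|rewrite ler_nat].
have mc : cvg (m n @[n --> \oo]).
  by apply: nondecreasing_is_cvgn => //; exists M => _ [n _ <-].
have /choice[y yP] n : exists y,
    qform W C (x - y) + qform W (a n) y <= m n + harmonic n.
  by apply: parq_near; exact: harmonic_gt0.
have h0 := @cvg_harmonic R.
have hge0 n : 0 <= harmonic n :> R by exact: harmonic_ge0.
have ya : qform W A (y n) @[n --> \oo] --> 0.
  apply: (squeeze_cvgr (f := cst 0) (h := fun n => (M + 1) * harmonic n)).
  - near=> n; rewrite qform_ge0//= /harmonic ler_pdivlMr// mulrC -aE.
    have := yP n; have := mM n; have := qform_ge0 (x - y n) C0.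
    have : harmonic n <= 1 :> R by rewrite /harmonic invf_le1// ler1n.
    lra.
  - exact: cvg_cst.
  - rewrite -[X in _ --> X](mulr0 (M + 1)).
    by apply: cvgM => //; exact: cvg_cst.
have yC n l : qform W C (y n - y l)
    <= 2 * (`|m n - m l| + harmonic n + harmonic l).
  wlog nl : n l / (n <= l)%N.
    move=> H; case: (leqP n l) => [/H//|/ltnW/H].
    by rewrite -opprB qformN distrC addrAC.
  pose w := 2^-1%:C *: (y n + y l).
  have xw : x - w = 2^-1%:C *: ((x - y n) + (x - y l)).
    by rewrite addrACA -opprD scalerBr scalerDr -halfD.
  have := parq_le C0 (a0 n) x w; rewrite -/(m n) xw !qformZ_real !aE.
  have := qformD_le (y n) (y l) A0.
  have := qform_parallelogram W C (x - y n) (x - y l).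
  rewrite [x - y n - _](_ : _ = - (y n - y l)) ?qformN; last first.
    by rewrite !opprB addrC addrA subrK.
  have := yP n; have := yP l; rewrite !aE.
  have : m n <= m l by exact: m_homo.
  move=> mnl; rewrite ler0_norm ?subr_le0//.
  have nl' : n.+1%:R <= l.+1%:R :> R by rewrite ler_nat.
  have n0 : 0 <= n.+1%:R :> R by [].
  have := ler_wpM2r (qform_ge0 (y l) A0) nl'.
  have := ler_wpM2l n0 (qformD_le (y n) (y l) A0).
  lra.
have yC0 : (fun nm => qform W C (y nm.1 - y nm.2)) @ (\oo, \oo) --> 0.
  have c1 (u : nat -> R) l : u n @[n --> \oo] --> l ->
      (fun nm : nat * nat => u nm.1) @ (\oo, \oo) --> l.
    by move=> ul; apply: cvg_comp ul; exact: cvg_fst.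
  have c2 (u : nat -> R) l : u n @[n --> \oo] --> l ->
      (fun nm : nat * nat => u nm.2) @ (\oo, \oo) --> l.
    by move=> ul; apply: cvg_comp ul; exact: cvg_snd.
  apply: (squeeze_cvgr (f := cst 0)
    (h := fun nm => 2 * (`|m nm.1 - m nm.2| + harmonic nm.1 + harmonic nm.2))).
  - by near=> nm; rewrite qform_ge0//= yC.
  - exact: cvg_cst.
  - pose lm := lim (m n @[n --> \oo]).
    rewrite (_ : 0 = 2 * (`|lm - lm| + 0 + 0)); last first.
      by rewrite subrr normr0 !addr0 mulr0.
    apply: cvgM; first exact: cvg_cst.
    apply: cvgD; last exact: c2.
    apply: cvgD; last exact: c1.
    by apply: cvg_norm; apply: cvgB; [exact: c1|exact: c2].
have yC1 := CA y ya yC0.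
have M0 : 0 <= M by apply: le_trans (mM 0%N); exact: parq_ge0.
apply/ler_addgt0Pr => e e0; pose s := e / (M + 1).
have M1 : 0 < M + 1 by rewrite ltr_wpDl.
have s0 : 0 < s by rewrite divr_gt0.
have sM : s * M <= e.
  by rewrite /s mulrAC ler_pdivrMr// ler_pM2l// lerDl.
have lim_le : (s + s ^+ 2) * (M + harmonic n) + (1 + s) * qform W C (y n)
    @[n --> \oo] --> (s + s ^+ 2) * (M + 0) + (1 + s) * 0.
  apply: cvgD; last by apply: cvgM => //; exact: cvg_cst.
  apply: cvgM; first exact: cvg_cst.
  by apply: cvgD; first exact: cvg_cst.
suff : s * qform W C x <= (s + s ^+ 2) * (M + 0) + (1 + s) * 0 by nra.
apply: (ler_cvg_to (cvg_cst _) lim_le); near=> n.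
rewrite -[in leLHS](subrK (y n) x).
apply: le_trans (qformD_le_scaled s (x - y n) (y n) C0) _.
rewrite lerD2r ler_wpM2l ?addr_ge0 ?sqr_ge0 ?(ltW s0)//.
have := yP n; have := mM n; have := qform_ge0 (y n) (a0 n); lra.
Unshelve. all: by end_near. Qed.

End AbsoluteContinuity.

(** * The Lebesgue decomposition *)

Section Lebesgue.
Context (R : realType) (F E : lmodType R[i]) (W : anti_dual_pair F E).
Variables A B : {linear E -> F}.
Hypotheses (A0 : positive_op W A) (B0 : positive_op W B).
Hypothesis wc : wstar_seq_complete W.

Local Notation B_ := (parallel_seq W A B).
Local Notation Bs := (strong_limit W B_).

Lemma parallel_seq_pos n : positive_op W (B_ n).
Proof.
elim: n => //= n Bn0; have [P0 PE] := parallel_sumP wc Bn0 A0.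
by apply: positive_opB => // x; rewrite PE; exact: parq_lel.
Qed.

Lemma parallel_seqS n x :
  qform W (B_ n.+1) x = qform W (B_ n) x - parq W (B_ n) A x.
Proof.
have [_ PE] := parallel_sumP wc (parallel_seq_pos n) A0.
by rewrite [LHS]qformB_op PE.
Qed.

Lemma parallel_seq_decr n x : qform W (B_ n.+1) x <= qform W (B_ n) x.
Proof. by rewrite parallel_seqS gerBl parq_ge0//; exact: parallel_seq_pos. Qed.

Lemma strong_limit_pos : positive_op W Bs.
Proof. by have [] := strong_limitP parallel_seq_pos parallel_seq_decr wc. Qed.

Lemma parallel_seq_cvg x : qform W (B_ n) x @[n --> \oo] --> qform W Bs x.
Proof. by have [] := strong_limitP parallel_seq_pos parallel_seq_decr wc. Qed.

Lemma strong_limit_le n x : qform W Bs x <= qform W (B_ n) x.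
Proof.
rewrite -(cvg_lim _ (@parallel_seq_cvg x))//.
apply: nonincreasing_cvgn_ge; last exact: cvgP (@parallel_seq_cvg x).
exact: qform_homo parallel_seq_decr x.
Qed.

Lemma parallel_seq_dominated n x :
  qform W (B \- B_ n) x <= n%:R * qform W A x.
Proof.
rewrite qformB_op; elim: n => [|n IH]; first by rewrite subrr mul0r.
rewrite parallel_seqS -natr1 mulrDl mul1r.
have := parq_ler (parallel_seq_pos n) A0 x; lra.
Qed.

Lemma regular_part_pos : positive_op W (B \- Bs).
Proof.
apply: positive_opB => //; first exact: strong_limit_pos.
exact: (strong_limit_le 0).
Qed.

(** The parallelogram law bounds the form of [B - B_ j] at [x_ n] by twice that
    of [B - Bs] at [x_ n - x_ l], which is small for [n] and [l] large, plus
    [2 * j * qform W A (x_ l)].  Letting [l] and then [j] tend to infinity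
    bounds the form of [B - Bs] at [x_ n]. *)
Lemma regular_part_abs_continuous : abs_continuous W (B \- Bs) A.
Proof.
apply/abs_continuousP => //; first exact: regular_part_pos.
move=> x_ /cvgrPdist_le xA xD.
apply/cvgrPdist_le => e e0; have e4 : 0 < e / 4 by rewrite divr_gt0.
move/cvgrPdist_le : xD => /(_ _ e4) [[P Q] /= [[N _ NP] [N' _ NQ]] PQ].
exists (maxn N N') => // n /=; rewrite geq_max => /andP[Nn N'n].
rewrite sub0r normrN ger0_norm; last exact: qform_ge0 regular_part_pos.
have Dn : qform W (B \- B_ j) (x_ n) @[j --> \oo] --> qform W (B \- Bs) (x_ n).
  rewrite qformB_op; under eq_fun do rewrite qformB_op.
  by apply: cvgB; [exact: cvg_cst|exact: parallel_seq_cvg].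
apply: (ler_cvg_to Dn (cvg_cst e)); near=> j.
have Dj0 : positive_op W (B \- B_ j).
  apply: positive_opB => //; first exact: parallel_seq_pos.
  by move=> x; exact: (qform_homo parallel_seq_decr x (leq0n j)).
have ej : 0 < e / 4 / j.+1%:R by rewrite divr_gt0.
have [L _ LP] := xA _ ej.
pose l := maxn N' L.
have Al : j%:R * qform W A (x_ l) <= e / 4.
  have := LP l (leq_maxr _ _); rewrite /= sub0r normrN ger0_norm ?qform_ge0//.
  rewrite ler_pdivlMr// mulrC; apply: le_trans.
  by rewrite ler_wpM2r ?qform_ge0// ler_nat.
have := PQ (n, l) (conj (NP n Nn) (NQ l (leq_maxl _ _))).
rewrite /= sub0r normrN ger0_norm; last exact: qform_ge0 regular_part_pos.
have : qform W (B \- B_ j) (x_ n - x_ l) <= qform W (B \- Bs) (x_ n - x_ l).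
  by rewrite !qformB_op lerD2l lerN2 strong_limit_le.
have := qformD_le (x_ n - x_ l) (x_ l) Dj0; rewrite subrK.
have := parallel_seq_dominated j (x_ l); lra.
Unshelve. all: by end_near. Qed.

Lemma parq_telescope (k : R) n x : 0 <= k ->
  parq W B (k%:C \*: A) x
    <= parq W (B_ n) (k%:C \*: A) x + (qform W B x - qform W (B_ n) x).
Proof.
move=> k0; elim: n => [|n IH]; first by rewrite subrr addr0.
have [P0 PE] := parallel_sumP wc (parallel_seq_pos n) A0.
have := parq_step A0 (parallel_seq_pos n) P0 PE x k0.
have := parallel_seqS n x; rewrite PE; lra.
Qed.

Lemma parq_le_regular_part (k : R) x : 1 <= k ->
  parq W B (k%:C \*: A) x <= qform W (B \- Bs) x.
Proof.
move=> k1; have k0 : 0 <= k by exact: le_trans k1.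
have lc : k * (qform W (B_ n) x - qform W (B_ n.+1) x)
    + (qform W B x - qform W (B_ n) x) @[n --> \oo]
    --> k * (qform W Bs x - qform W Bs x) + (qform W B x - qform W Bs x).
  have c0 := @parallel_seq_cvg x.
  have c1 : qform W (B_ n.+1) x @[n --> \oo] --> qform W Bs x.
    by rewrite (cvg_shiftS (fun n => qform W (B_ n) x)).
  apply: cvgD; last by apply: cvgB => //; exact: cvg_cst.
  by apply: cvgM; [exact: cvg_cst|apply: cvgB].
rewrite qformB_op -[leRHS]add0r -[X in _ <= X + _](mulr0 k).
rewrite -(subrr (qform W Bs x)).
apply: (ler_cvg_to (cvg_cst _) lc); near=> n.
apply: le_trans (parq_telescope n x k0) _; rewrite lerD2r.
have -> : qform W (B_ n) x - qform W (B_ n.+1) x = parq W (B_ n) A x.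
  by rewrite parallel_seqS opprB addrC subrK.
exact: parqZr_le (parallel_seq_pos n) A0 k1.
Unshelve. all: by end_near. Qed.

End Lebesgue.

Theorem corollary3p5 (R : realType) (F E : lmodType R[i])
    (W : anti_dual_pair F E) (A B : {linear E -> F}) :
  wstar_seq_complete W ->
  positive_op W A ->
  positive_op W B ->
  is_largest_op W
    [set C : {linear E -> F} |
      [/\ positive_op W C, op_le W C B & abs_continuous W C A]]
    (B \- strong_limit W (parallel_seq W A B)).
Proof.
move=> wc A0 B0; have D0 := regular_part_pos A0 B0 wc; split.
  split=> //; last exact: regular_part_abs_continuous.
  apply/op_leP => // x; rewrite qformB_op gerBl.
  by apply: qform_ge0; exact: strong_limit_pos.
move=> C [C0 /(op_leP C0 B0) CB CA]; apply/op_leP => // x.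
apply: (abs_continuous_le_parq A0 C0 CA) => k k1.
apply: le_trans (parq_le_regular_part A0 B0 wc x k1).
have kA0 : positive_op W (k%:C \*: A).
  by apply: positive_opZ => //; exact: le_trans k1.
apply: le_parq => y; apply: le_trans (parq_le C0 kA0 x y) _.
by rewrite lerD2r CB.
Qed.
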